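(* Let $N\ge1$, $\delta>0$, $\alpha>0$. Suppose each $c_n:\mathbb{R}\to\mathbb{R}$ ($n=1,\dots,N$) is continuous, satisfies $c_n(s)=0$ for $s\le 0$, is convex and strictly increasing on $[0,\infty)$, and satisfies $\frac{\partial^+c_n(0)}{\partial s_n}\ge\frac{\alpha}{2N}$. Suppose the social cost minimization problem has an optimal solution $(\mathbf{s}^*,y^* )$ with $y^*>0$. Then there exists a unique price-anticipating market equilibrium $(\mathbf{b}^a,p^a,y^a)$ of the game with payoffs $(Q_1,\dots,Q_N)$. For this equilibrium, the vector $\mathbf{s}^a$ defined by $s_n^a=S(b_n^a,p^a)$ (together with $y^a$) is the unique optimal solution of $$\min_{\mathbf{s},y}\ \sum_n\hat c_n(s_n)+\frac{\alpha}{2N\delta}\bigl(y+(N-1)\delta\bigr)^2\quad\text{s.t.}\quad\sum_n s_n=\delta-y,\quad y\ge0,\ s_n\ge0\ (n=1,\dots,N),$$ where, for $s_n\ge0$, $$\hat c_n(s_n)=\frac12\Bigl(c_n(s_n)+s_n\frac{\alpha}{2N}\Bigr)+\frac12\int_0^{s_n}\sqrt{\Bigl(\frac{\partial^+c_n(z)}{\partial z}-\frac{\alpha}{2N}\Bigr)^2+2\,\frac{\partial^+c_n(z)}{\partial z}\,\frac{z\alpha}{N\delta}}\;dz,$$ and $\hat c_n(s_n)=0$ for $s_n<0$.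
   Context: There are $N$ tenants; $\delta$ is the total energy reduction target; $y$ is the amount of on-site generation, with unit cost $\alpha$. $\partial^+$ denotes right derivative. The social cost minimization problem is $$\min\ \alpha y+\sum_{i=1}^N c_i(s_i)\quad\text{s.t.}\quad y+\sum_{i=1}^N s_i=\delta,\ s_i\ge0,\ y\ge0.$$ Supply function: $S(b_n,p)=\delta-\frac{b_n}{p}$. Clearing price: $p(\mathbf{b},y)=\frac{\sum_n b_n}{(N-1)\delta+y}$ (conventions $0/0=0$, $x/0=+\infty$ for $x>0$). When the operator minimizes cost with interior $y$, the price becomes $p(\mathbf{b})=\sqrt{\frac{(\sum_n b_n)\alpha}{N\delta}}$, and a price-anticipating tenant has payoff $p(\mathbf b)S(b_n,p(\mathbf b))-c_n(S(b_n,p(\mathbf b)))$, i.e. $$Q_n(b_n;\mathbf{b}_{-n})=\sqrt{\frac{(\sum_m b_m)\alpha\delta}{N}}-b_n-c_n\!\left(\delta-\frac{b_n}{\sqrt{\sum_m b_m}}\sqrt{\frac{N\delta}{\alpha}}\right),$$ defined for bid vectors $\mathbf b\ge 0$ with $\sum_m b_m>0$, where $\mathbf{b}_{-n}$ is the vector of the bids of the other tenants. A price-anticipating market equilibrium is a triple $(\mathbf{b},p,y)$ with $\mathbf{b}\ge0$ such that $Q_n(b_n;\mathbf{b}_{-n})\ge Q_n(\bar b_n;\mathbf{b}_{-n})$ for all $\bar b_n\ge0$ (for which the right side is defined) and all $n$; $p=p(\mathbf{b},y)$; and $y\in\arg\min_{0\le y'\le\delta}(\delta-y')p(\mathbf{b},y')+\alpha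 y'$. *)

(* Defs.v *)
From HB Require Import structures.
From mathcomp Require Import all_boot all_order all_algebra.
From mathcomp Require Import all_classical all_reals all_analysis.
Import Order.TTheory GRing.Theory Num.Theory.
Import numFieldNormedType.Exports.

Set Implicit Arguments.
Unset Strict Implicit.
Unset Printing Implicit Defensive.

Local Open Scope classical_set_scope.
Local Open Scope ring_scope.

Definition argmin {disp : Order.disp_t} {O : porderType disp} {T : Type}
    (D : set T) (f : T -> O) : set T :=
  [set x | D x /\ forall x', D x' -> (f x <= f x')%O].

Definition right_derivative {R : realType} (f : R -> R) (x : R) : R :=
  lim ((f (x + h) - f x) / h @[h --> 0^'+]).

Section Market.
Context {R : realType} {N : nat}.
Variables (delta alpha : R).
Implicit Types (c : 'I_N -> R -> R) (b s : 'I_N -> R) (n : 'I_N).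

Definition feasible : set (('I_N -> R) * R) :=
  [set sy | [/\ sy.2 + \sum_i sy.1 i = delta,
                (forall i, 0 <= sy.1 i) & 0 <= sy.2]].

Definition social_cost c (sy : ('I_N -> R) * R) : R :=
  alpha * sy.2 + \sum_i c i (sy.1 i).

(* Prices live in \bar R, whose division satisfies 0 / 0 = 0,
   x / 0 = +oo for x > 0, and x / +oo = 0 for real x. *)
Definition supply (bn : R) (p : \bar R) : \bar R :=
  (delta%:E - bn%:E / p)%E.

Definition clearing_price b (y : R) : \bar R :=
  ((\sum_i b i)%:E / ((N%:R - 1) * delta + y)%:E)%E.

Definition operator_cost b (y : R) : \bar R :=
  ((delta - y)%:E * clearing_price b y + (alpha * y)%:E)%E.

Definition valid_bids b : Prop := (forall i, 0 <= b i) /\ 0 < \sum_i b i.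

(* Meaningful only when [valid_bids b]. *)
Definition payoff c n b : R :=
  Num.sqrt ((\sum_m b m) * alpha * delta / N%:R) - b n
  - c n (delta - b n / Num.sqrt (\sum_m b m) * Num.sqrt (N%:R * delta / alpha)).

(* The bids must themselves be valid for [payoff c n b] to be defined. *)
Definition market_equilibrium c b (p : \bar R) (y : R) : Prop :=
  [/\ valid_bids b,
      (forall n (x : R), valid_bids [eta b with n |-> x] ->
         payoff c n [eta b with n |-> x] <= payoff c n b),
      p = clearing_price b y
    & argmin `[0, delta] (operator_cost b) y].

Definition modified_cost c n (s : R) : R :=
  if 0 <= s then
    2^-1 * (c n s + s * (alpha / (2 * N%:R)))
    + 2^-1 * \int[lebesgue_measure]_(z in `[0, s])
        Num.sqrt ((right_derivative (c n) z - alpha / (2 * N%:R)) ^+ 2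
          + 2 * right_derivative (c n) z * (z * alpha / (N%:R * delta)))
  else 0.

Definition modified_social_cost c (sy : ('I_N -> R) * R) : R :=
  \sum_i modified_cost c i (sy.1 i)
  + alpha / (2 * N%:R * delta) * (sy.2 + (N%:R - 1) * delta) ^+ 2.

End Market.

(* Main.v *)
Require Import Defs.
From HB Require Import structures.
From mathcomp Require Import all_boot all_order all_algebra.
From mathcomp Require Import all_classical all_reals all_analysis.
From mathcomp Require Import ring lra.
Import Order.TTheory GRing.Theory Num.Theory.
Import numFieldNormedType.Exports.

Local Open Scope classical_set_scope.
Local Open Scope ring_scope.

(* Put K = N delta / alpha. When the bids sum to P^2 K the price is P; tenant n
   then supplies s_n = delta - b_n / P and earns P s_n - c_n(s_n). With
   w = 2 K P - delta, the bids are an equilibrium iff w > 0 and, for every n,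
   s_n >= 0 and P w / (w + s_n) is a subgradient of c_n at s_n. Solving
   x = P w / (w + s) for P gives the derivative of the modified cost at a point s
   where c_n has slope x, so the condition says that P is a subgradient of the
   modified cost at s_n. Since P = alpha / (N delta) (y + (N-1) delta), this is the
   first-order condition of the modified problem, which is strictly convex and has
   a compact feasible set. That y > 0 in both problems comes from the social
   optimum (r, z): if y <= 0 then P < alpha, so all marginal costs below s are less
   than alpha, whereas z > 0 makes them at least alpha beyond r; hence s <= r, and
   the sum of the s_n is at most delta - z < delta. *)

(** * Convex functions and their slopes *)

(** Otherwise [e] could be taken so small that [C * e] is less than [A - B]. The first-order
    arguments below let [e] tend to 0 through this lemma. *)
Lemma le_of_linear_error (R : realFieldType) (A B C e0 : R) :
  0 < e0 -> (forall e, 0 < e -> e < e0 -> A <= B + C * e) -> A <= B.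
Proof.
move=> e0_gt0 H; rewrite leNgt; apply/negP => AB.
have C1 : 0 < `|C| + 1 by have := normr_ge0 C; lra.
pose e := Num.min (e0 / 2) ((A - B) / (`|C| + 1) / 2).
have e_gt0 : 0 < e by rewrite /e lt_min !divr_gt0 ?subr_gt0.
have ee0 : e < e0 by rewrite /e gt_min; apply/orP; left; lra.
have := H e e_gt0 ee0.
have eAB : e * (`|C| + 1) <= (A - B) / 2.
  rewrite -ler_pdivlMr// mulrAC /e ge_min; apply/orP; right; exact: lexx.
have CC : C * e <= `|C| * e by rewrite ler_wpM2r ?ler_norm// ltW.
lra.
Qed.

(* For convex [f] this says that [d x] lies between the two one-sided
   derivatives at [x]; stating it through increments avoids left derivatives. *)
Definition slopes_within {R : numDomainType} (f d : R -> R) : Prop :=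
  forall x t, 0 <= x -> x < t ->
    d x * (t - x) <= f t - f x /\ f t - f x <= d t * (t - x).

Section RightDerivative.
Context {R : realType} (f : R -> R).
Hypothesis f_convex :
  convex_function (`[0, +oo[%classic : set R^o) (f : R^o -> R^o).

Lemma convex_three_slopes (x y z : R) : 0 <= x -> x < y -> y < z ->
  (f y - f x) * (z - y) <= (f z - f y) * (y - x).
Proof.
move=> x0 xy yz.
have zx : 0 < z - x by lra.
have t01 : 0 <= (z - y) / (z - x) <= 1.
  by rewrite divr_ge0 ?ler_pdivrMr//=; lra.
pose t : {i01 R} := Itv01 (proj1 (andP t01)) (proj2 (andP t01)).
have H : f ((z - y) / (z - x) * x + (1 - (z - y) / (z - x)) * z) <=
    (z - y) / (z - x) * f x + (1 - (z - y) / (z - x)) * f z.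
  by apply: (f_convex t); rewrite inE/= in_itv/= andbT; lra.
move: H.
have -> : (z - y) / (z - x) * x + (1 - (z - y) / (z - x)) * z = y :> R.
  by field; rewrite gt_eqF.
have -> : (z - y) / (z - x) * f x + (1 - (z - y) / (z - x)) * f z
   = ((z - y) * f x + (y - x) * f z) / (z - x) :> R.
  by field; rewrite gt_eqF.
rewrite ler_pdivlMr// => H.
lra.
Qed.

Hypothesis f_nondecreasing : forall x t : R, 0 <= x -> x < t -> f x <= f t.

Let quotient (x h : R) := (f (x + h) - f x) / h.

Lemma difference_quotient_le (x h k : R) : 0 <= x -> 0 < h -> h <= k ->
  quotient x h <= quotient x k.
Proof.
move=> x0 h0; rewrite le_eqVlt => /orP[/eqP->//|hk].
have k0 : 0 < k by lra.
rewrite /quotient ler_pdivrMr// mulrAC ler_pdivlMr//.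
have := @convex_three_slopes x (x + h) (x + k) x0 ltac:(lra) ltac:(lra).
lra.
Qed.

(** By convexity the quotient decreases with [h], and monotonicity of [f] bounds it below by 0, so
    the limit is finite also at [x = 0]. *)
Lemma right_derivative_cvg (x : R) : 0 <= x ->
  quotient x h @[h --> 0^'+] --> right_derivative f x.
Proof.
move=> x0.
(* [right_derivative] unfolds to the [lim] of this filter, so the existence of a limit is enough. *)
suff : cvg (quotient x h @[h --> 0^'+]) by [].
apply/cvg_ex; eexists.
apply: (@nondecreasing_at_right_cvgr _ (quotient x) 0 (BLeft 1)).
- by rewrite bnd_simp.
- move=> h k; rewrite !in_itv/= => /andP[h0 _] /andP[k0 _] hk.
  exact: difference_quotient_le.
- exists 0 => _ [h + <-]; rewrite /= in_itv/= => /andP[h0 _].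
  rewrite /quotient divr_ge0 ?(ltW h0) ?subr_ge0//.
  by apply: f_nondecreasing => //; lra.
Qed.

Lemma convex_slopes_within : slopes_within f (right_derivative f).
Proof.
move=> x t x0 xt; split.
  rewrite -ler_pdivlMr ?subr_gt0//.
  apply: (cvgr_to_le (right_derivative_cvg _ x0)).
  near=> h.
  have h0 : 0 < h by near: h; exact: nbhs_right_gt.
  have ht : h <= t - x by near: h; apply: nbhs_right_le; rewrite subr_gt0.
  by have := difference_quotient_le _ _ _ x0 h0 ht; rewrite /quotient subrKC.
rewrite -ler_pdivrMr ?subr_gt0//.
apply: (cvgr_to_ge (right_derivative_cvg t _)); first by lra.
near=> h.
have h0 : 0 < h by near: h; exact: nbhs_right_gt.
rewrite /quotient ler_pdivrMr ?subr_gt0// mulrAC ler_pdivlMr//.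
have := @convex_three_slopes x t (t + h) x0 xt ltac:(lra).
lra.
Unshelve. all: by end_near.
Qed.

End RightDerivative.

Section SlopesWithin.
Context {R : realFieldType} {f d : R -> R}.
Hypothesis fd : slopes_within f d.

Lemma slopes_within_nondecreasing (x t : R) : 0 <= x -> x <= t -> d x <= d t.
Proof.
move=> x0; rewrite le_eqVlt => /orP[/eqP->//|xt].
have [h1 h2] := fd _ _ x0 xt.
by rewrite -(ler_pM2r (_ : 0 < t - x)) ?subr_gt0//; apply: le_trans h1 h2.
Qed.

(** The chord from [t] to a point at distance [e] from [s] has its slope bounded by [p]; the
    remaining piece contributes an error linear in [e]. Only slopes off [s] are constrained, so at
    [s = 0] the first condition is void. *)
Lemma subgradient_of_slopes (s p : R) : 0 <= s ->
  (forall u : R, 0 <= u -> u < s -> d u <= p) -> (forall u, s < u -> p <= d u) ->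
  forall t, 0 <= t -> p * (t - s) <= f t - f s.
Proof.
move=> s0 dlt dgt t t0; have [ts|st|->] := ltgtP t s; last by lra.
  apply: (@le_of_linear_error _ _ _ (d s - p) (s - t)); first lra.
  move=> e e0 es.
  have [_ h1] := fd t (s - e) t0 ltac:(lra).
  have := dlt (s - e) ltac:(lra) ltac:(lra).
  have [_ h2] := fd (s - e) s ltac:(lra) ltac:(lra).
  rewrite -(ler_pM2r (_ : 0 < s - e - t)); last by lra.
  move=> h3.
  have h4 : f (s - e) - f t <= p * (s - e - t) by lra.
  nra.
apply: (@le_of_linear_error _ _ _ (p - d s) (t - s)); first lra.
move=> e e0 es.
have [h1 _] := fd s (s + e) s0 ltac:(lra).
have [h2 _] := fd (s + e) t ltac:(lra) ltac:(lra).
have := dgt (s + e) ltac:(lra).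
rewrite -(ler_pM2r (_ : 0 < t - (s + e))); last by lra.
move=> h3.
have h4 : p * (t - (s + e)) <= f t - f (s + e) by lra.
nra.
Qed.

(** On a step of length [e] the slack is [k * e ^+ 2], which vanishes after division by [e]. It
    makes room for the quadratic term of the modified problem. *)
Lemma slopes_le_of_subgradient (s p k : R) :
  (forall t, 0 <= t -> t < s -> f s - f t <= p * (s - t) + k * (s - t) ^+ 2) ->
  forall u : R, 0 <= u -> u < s -> d u <= p.
Proof.
move=> H u u0 us.
apply: (@le_of_linear_error _ _ _ k (s - u)); first lra.
move=> e e0 es.
have := H (s - e) ltac:(lra) ltac:(lra).
have [h1 _] := fd (s - e) s ltac:(lra) ltac:(lra).
have h2 := slopes_within_nondecreasing u (s - e) u0 ltac:(lra).
have -> : s - (s - e) = e by ring.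
rewrite (_ : s - (s - e) = e) in h1; last by ring.
move=> h3; rewrite -(ler_pM2r e0); apply: (@le_trans _ _ (d (s - e) * e)).
  by rewrite ler_pM2r.
by apply: le_trans h1 (le_trans h3 _); rewrite mulrDl expr2 mulrA.
Qed.

(** The inequality is asked only up to [s + e0] because a tenant's supply can grow only while there
    is on-site generation to replace. *)
Lemma slopes_ge_of_subgradient (s p k e0 : R) : 0 <= s -> 0 < e0 ->
  (forall t, s < t -> t <= s + e0 ->
     p * (t - s) <= f t - f s + k * (t - s) ^+ 2) ->
  forall u : R, s < u -> p <= d u.
Proof.
move=> s0 e00 H u us.
apply: (@le_of_linear_error _ _ _ k (Num.min e0 (u - s))).
  by rewrite lt_min e00; lra.
move=> e ep; rewrite lt_min => /andP[ee0 es].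
have := H (s + e) ltac:(lra) ltac:(lra).
have [_ h1] := fd s (s + e) ltac:(lra) ltac:(lra).
have h2 := slopes_within_nondecreasing (s + e) u ltac:(lra) ltac:(lra).
have eE : s + e - s = e by ring.
rewrite eE in h1 * => h3; rewrite -(ler_pM2r ep).
apply: le_trans h3 _.
rewrite mulrDl expr2 mulrA lerD2r.
by apply: le_trans h1 _; rewrite ler_pM2r.
Qed.

Lemma strict_subgradient_of_slopes (s p : R) :
  (forall x t, 0 <= x -> x < t -> d x < d t) -> 0 <= s ->
  (forall u : R, 0 <= u -> u < s -> d u <= p) -> (forall u, s < u -> p <= d u) ->
  forall t, 0 <= t -> t != s -> p * (t - s) < f t - f s.
Proof.
move=> d_incr s0 dlt dgt t t0.
have sub := subgradient_of_slopes s p s0 dlt dgt.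
rewrite neq_lt => /orP[ts|st].
  (* Up to [m] the slopes stay strictly below [p], since [d m] is less than a later slope that is at
     most [p]; the rest of the way the non-strict inequality suffices. *)
  pose m := (t + s) / 2; have tm : t < m by rewrite /m; lra.
  have ms : m < s by rewrite /m; lra.
  have := sub m ltac:(lra).
  have [_ h1] := fd t m t0 tm.
  have h2 := d_incr m ((m + s) / 2) ltac:(lra) ltac:(lra).
  have h3 := dlt ((m + s) / 2) ltac:(lra) ltac:(lra).
  have : d m * (m - t) < p * (m - t) by rewrite ltr_pM2r; lra.
  lra.
pose m := (s + t) / 2; have sm : s < m by rewrite /m; lra.
have mt : m < t by rewrite /m; lra.
have := sub m ltac:(lra).
have [h1 _] := fd m t ltac:(lra) mt.
have h2 := d_incr ((s + m) / 2) m ltac:(lra) ltac:(lra).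
have h3 := dgt ((s + m) / 2) ltac:(lra).
have : p * (t - m) < d m * (t - m) by rewrite ltr_pM2r; lra.
lra.
Qed.

End SlopesWithin.

(** Slopes on [[0, M]] lie between [d 0] and [d M], so [f] is Lipschitz on []-oo, M]], being flat
    left of 0. *)
Lemma slopes_within_continuous (R : realType) (f d : R -> R) :
  slopes_within f d -> (forall x, x <= 0 -> f x = 0) -> continuous f.
Proof.
move=> fd f0.
have lip M x y : x <= y -> y <= M ->
    `|f y - f x| <= (`|d 0| + `|d M|) * (y - x).
  set L := `|d 0| + `|d M|.
  have L0 : 0 <= L by rewrite addr_ge0.
  have pos x' y' : 0 <= x' -> x' <= y' -> y' <= M ->
      `|f y' - f x'| <= L * (y' - x').
    move=> x0; rewrite le_eqVlt => /orP[/eqP->|xy] yM.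
      by rewrite !subrr normr0 mulr0.
    have [h1 h2] := fd x' y' x0 xy.
    have dM := slopes_within_nondecreasing fd y' M ltac:(lra) yM.
    have d0 := slopes_within_nondecreasing fd 0 x' (lexx 0) x0.
    have h3 : - L <= d x'.
      have := ler_norm (- d 0); rewrite normrN.
      have := normr_ge0 (d M); rewrite /L; lra.
    have h4 : d y' <= L.
      by have := ler_norm (d M); have := normr_ge0 (d 0); rewrite /L; lra.
    rewrite ler_norml; apply/andP; split.
      by rewrite -mulNr; apply: le_trans h1; rewrite ler_pM2r; lra.
    by apply: (le_trans h2); rewrite ler_pM2r; lra.
  move=> xy yM; have [x0|x0] := leP 0 x; first exact: pos.
  have [y0|y0] := leP y 0.
    by rewrite !f0 ?(ltW x0)// subrr normr0 mulr_ge0//; lra.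
  rewrite (f0 x (ltW x0)) -(f0 0 (lexx 0)).
  apply: (le_trans (pos 0 y (lexx 0) (ltW y0) yM)).
  by rewrite ler_wpM2l//; lra.
move=> x; apply/cvgrPdist_le => e e0.
set L := `|d 0| + `|d (x + 1)| + 1.
have L0 : 0 < L by rewrite ltr_wpDl// addr_ge0.
near=> y.
have yx : `|x - y| <= 1.
  by near: y; apply: cvgr_dist_le => //; exact: cvg_id.
have yxe : `|x - y| <= e / L.
  near: y; apply: cvgr_dist_le; first exact: cvg_id.
  by rewrite divr_gt0.
have step : `|f x - f y| <= L * `|x - y|.
  have [xy|xy] := leP x y.
    rewrite distrC (distrC x) (ger0_norm (_ : 0 <= y - x)) ?subr_ge0//.
    apply: (le_trans (lip (x + 1) x y xy _)).
      by move: yx; rewrite ler_norml; lra.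
    by rewrite ler_wpM2r ?subr_ge0// /L; lra.
  rewrite (ger0_norm (_ : 0 <= x - y)) ?subr_ge0 ?(ltW xy)//.
  apply: (le_trans (lip (x + 1) y x (ltW xy) _)); first by lra.
  by rewrite ler_wpM2r ?subr_ge0 ?(ltW xy)// /L; lra.
apply: (le_trans step); rewrite mulrC -ler_pdivlMr//.
Unshelve. all: by end_near.
Qed.

(** * The modified cost *)

Section IntegralOfMonotone.
Context {R : realType} (G : R -> R).
Hypothesis G_nondecreasing : forall x t : R, 0 <= x -> x <= t -> G x <= G t.
Hypothesis G_ge0 : forall x : R, 0 <= x -> 0 <= G x.

Lemma nondecreasing_integrable (t : R) :
  lebesgue_measure.-integrable `[0, t] (EFin \o G).
Proof.
apply: measurable_bounded_integrable => //=.
- by rewrite lebesgue_measure_itv/=; case: ifP => // _; rewrite -EFinB ltry.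
(* [G] is monotone only on [[0, +oo[]; composed with [Num.max z 0] it is monotone on the whole line,
   hence measurable. *)
- have GE : {in `[0, t]%classic, (fun z : R => G (Num.max z 0)) =1 G}.
    by move=> z; rewrite inE/= in_itv/= => /andP[z0 _]; rewrite max_l.
  apply: (eq_measurable_fun _ GE).
  apply: measurable_realfun.nondecreasing_measurable => // x y xy.
  apply: G_nondecreasing; first by rewrite le_max lexx orbT.
  by rewrite ge_max !le_max xy lexx orbT.
- exists (G t); split=> [|M tM z /=]; first exact: num_real.
  rewrite in_itv/= => /andP[z0 zt].
  by rewrite ger0_norm ?G_ge0// (le_trans _ (ltW tM))// G_nondecreasing.
Qed.

(** The increment is the integral over []x, t]], where the integrand lies between [G x] and
    [G t]. *)
Lemma integral_slopes_within :
  slopes_within (fun s => \int[lebesgue_measure]_(z in `[0, s]) G z) G.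
Proof.
move=> x t x0 xt.
rewrite (Rintegral_itvB (nondecreasing_integrable t)) ?bnd_simp//; last exact: ltW.
have mxt : fine (lebesgue_measure `]x, t]%classic) = t - x.
  by rewrite lebesgue_measure_itv/= lte_fin xt.
have iG : lebesgue_measure.-integrable `]x, t] (EFin \o G).
  apply: integrableS (nondecreasing_integrable t) => //.
  by apply: subset_itv; rewrite bnd_simp.
have icst r : lebesgue_measure.-integrable `]x, t] (EFin \o cst r).
  apply: measurable_bounded_integrable => //=.
    by rewrite lebesgue_measure_itv/= lte_fin xt -EFinB ltry.
  by exists `|r|; split=> [|M rM z _ /=]; [exact: num_real|exact: ltW].
rewrite -mxt -!(Rintegral_cst lebesgue_measure (measurable_itv _)).
split; apply: le_Rintegral => //; try exact: icst;
  move=> z /=; rewrite in_itv/= => /andP[xz zt]; apply: G_nondecreasing => //;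
  lra.
Qed.

End IntegralOfMonotone.

Section ModifiedMarginalCost.
Context {R : realType} (a k : R).
Hypotheses (a_gt0 : 0 < a) (k_gt0 : 0 < k).

Definition modified_marginal (x z : R) : R :=
  2^-1 * (x + a) + 2^-1 * Num.sqrt ((x - a) ^+ 2 + 2 * x * (z * k)).

(** Compares the two squares that arise when the root in [modified_marginal x z <= p] is
    isolated. *)
Let modified_radicand (x z p : R) :
  (2 * p - x - a) ^+ 2 - ((x - a) ^+ 2 + 2 * x * (z * k)) =
  4 * ((p - x) * (p - a)) - 2 * x * (z * k).
Proof. by ring. Qed.

(* [modified_marginal x z] is the larger root [p] of
   [2 (p - x) (p - a) = k x z]. *)
Lemma modified_marginal_le (x z p : R) : 0 <= x -> 0 <= z -> a < p ->
  (modified_marginal x z <= p) = (k * x * z <= 2 * (p - x) * (p - a)).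
Proof.
move=> x0 z0 ap.
have xzk : 0 <= x * (z * k) by rewrite !mulr_ge0 ?(ltW k_gt0).
have r0 : 0 <= (x - a) ^+ 2 + 2 * x * (z * k).
  by rewrite addr_ge0 ?sqr_ge0// -mulrA mulr_ge0.
have id := modified_radicand x z p.
have -> : (modified_marginal x z <= p) =
    (Num.sqrt ((x - a) ^+ 2 + 2 * x * (z * k)) <= 2 * p - x - a).
  by rewrite /modified_marginal; apply/idP/idP; lra.
have sq0 := sqrtr_ge0 ((x - a) ^+ 2 + 2 * x * (z * k)).
have sqE := sqr_sqrtr r0.
set q := Num.sqrt _ in sq0 sqE *.
apply/idP/idP => H.
  have : q ^+ 2 <= (2 * p - x - a) ^+ 2 by rewrite ler_sqr ?nnegrE; lra.
  lra.
(* Together with [a < p] this makes [2 * p - x - a] nonnegative, so that the squaring can be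
   undone. *)
have xp : x <= p.
  have : 0 <= (p - x) * (p - a) by lra.
  by rewrite pmulr_lge0 ?subr_gt0// subr_ge0.
rewrite -(ler_pXn2r (n := 2)) ?nnegrE//; last by lra.
lra.
Qed.

Lemma modified_marginal_ge (x z p : R) : 0 <= x -> 0 <= z -> a < p ->
  (p <= modified_marginal x z) = (2 * (p - x) * (p - a) <= k * x * z).
Proof.
move=> x0 z0 ap.
have xzk : 0 <= x * (z * k) by rewrite !mulr_ge0 ?(ltW k_gt0).
have r0 : 0 <= (x - a) ^+ 2 + 2 * x * (z * k).
  by rewrite addr_ge0 ?sqr_ge0// -mulrA mulr_ge0.
have id := modified_radicand x z p.
have -> : (p <= modified_marginal x z) =
    (2 * p - x - a <= Num.sqrt ((x - a) ^+ 2 + 2 * x * (z * k))).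
  by rewrite /modified_marginal; apply/idP/idP; lra.
have sq0 := sqrtr_ge0 ((x - a) ^+ 2 + 2 * x * (z * k)).
have sqE := sqr_sqrtr r0.
set q := Num.sqrt _ in sq0 sqE *.
(* In the negative case [p < x], because [a < p]; both inequalities then hold, the second having a
   nonpositive left side. *)
have [r_lt0|r_ge0] := ltP (2 * p - x - a) 0.
  rewrite (le_trans (ltW r_lt0) sq0); apply/esym.
  have xp : p <= x by lra.
  apply: (@le_trans _ _ 0); last by lra.
  by rewrite -mulrA pmulr_rle0// pmulr_lle0 ?subr_gt0// subr_le0.
rewrite -(ler_pXn2r (n := 2)) ?nnegrE//.
by apply/idP/idP; lra.
Qed.

Lemma modified_marginal_gt (x z : R) : a <= x -> 0 < z ->
  Num.max a x < modified_marginal x z.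
Proof.
move=> ax z0; rewrite max_r// /modified_marginal.
have xzk : 0 < x * (z * k) by rewrite !mulr_gt0// (lt_le_trans a_gt0).
have : x - a < Num.sqrt ((x - a) ^+ 2 + 2 * x * (z * k)).
  rewrite -{1}(ger0_norm (_ : 0 <= x - a)) ?subr_ge0//.
  have xa2 := sqr_ge0 (x - a).
  rewrite -sqrtr_sqr ltr_sqrt; lra.
lra.
Qed.

(** The term with [z] under the root makes the marginal strictly increasing even where the slope [x]
    is constant. Strict convexity of the modified cost rests on this. *)
Lemma modified_marginal_lt (x x' z z' : R) :
  a <= x -> x <= x' -> 0 <= z -> z < z' ->
  modified_marginal x z < modified_marginal x' z'.
Proof.
move=> ax xx' z0 zz'; rewrite /modified_marginal.
suff : Num.sqrt ((x - a) ^+ 2 + 2 * x * (z * k)) <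
    Num.sqrt ((x' - a) ^+ 2 + 2 * x' * (z' * k)) by lra.
have xa2 : (x - a) ^+ 2 <= (x' - a) ^+ 2 by rewrite ler_sqr ?nnegrE; lra.
have xz : x * (z * k) < x' * (z' * k).
  apply: (@le_lt_trans _ _ (x' * (z * k))).
    by rewrite ler_wpM2r// mulr_ge0// ltW.
  by rewrite ltr_pM2l ?ltr_pM2r// (lt_le_trans a_gt0)// (le_trans ax).
have xzk : 0 <= x * (z * k).
  by rewrite !mulr_ge0 ?(ltW k_gt0)// (le_trans (ltW a_gt0)).
have xa0 := sqr_ge0 (x - a).
by rewrite ltr_sqrt; lra.
Qed.

End ModifiedMarginalCost.

Section ModifiedCost.
Context {R : realType} {N : nat} (delta alpha : R) (c : 'I_N -> R -> R).
Variable n : 'I_N.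
Hypotheses (delta_gt0 : 0 < delta) (alpha_gt0 : 0 < alpha).
Local Notation d := (right_derivative (c n)).
Hypothesis cd : slopes_within (c n) d.
Local Notation a := (alpha / (2 * N%:R)).
Local Notation k := (alpha / (N%:R * delta)).
Hypothesis d0 : a <= d 0.

Let N_gt0 : 0 < N%:R :> R.
Proof. by rewrite ltr0n (leq_ltn_trans _ (ltn_ord n)). Qed.

Lemma right_derivative_ge_reserve (x : R) : 0 <= x -> a <= d x.
Proof.
move=> x0; apply: (le_trans d0).
by apply: (slopes_within_nondecreasing cd) => //.
Qed.

(** Slopes add over the cost, the linear term and the integral. The integrand is monotone because
    the slopes of [c n] never fall below [a]. *)
Lemma modified_cost_slopes_within :
  slopes_within (modified_cost delta alpha c n)
    (fun z => modified_marginal a k (d z) z).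
Proof.
have N0 := N_gt0.
have a0 : 0 < a by rewrite divr_gt0 ?mulr_gt0.
have k0 : 0 < k by rewrite divr_gt0 ?mulr_gt0.
pose G z := Num.sqrt ((d z - a) ^+ 2 + 2 * d z * (z * k)).
have Gle x t : 0 <= x -> x <= t -> G x <= G t.
  move=> x0 xt; have dx := right_derivative_ge_reserve x x0.
  have dxt := slopes_within_nondecreasing cd x t x0 xt.
  apply: ler_wsqrtr; apply: lerD; first by rewrite ler_sqr ?nnegrE; lra.
  have d_ge0 : 0 <= d x by rewrite (le_trans (ltW a0)).
  apply: ler_pM; [by rewrite mulr_ge0|by rewrite mulr_ge0// ltW| |].
    by rewrite ler_pM2l.
  by rewrite ler_pM2r.
have GI := @integral_slopes_within _ G Gle (fun x _ => sqrtr_ge0 _).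
have mcE s : 0 <= s -> modified_cost delta alpha c n s =
    2^-1 * (c n s + s * a)
    + 2^-1 * \int[lebesgue_measure]_(z in `[0, s]) G z.
  move=> s0; rewrite /modified_cost s0; congr (_ + _ * _).
  by apply: eq_Rintegral => z _; rewrite /G !mulrA.
move=> x t x0 xt; rewrite !mcE//; last by rewrite (le_trans x0) ?ltW.
have [c1 c2] := cd x t x0 xt; have [G1 G2] := GI x t x0 xt.
by rewrite /modified_marginal -!/(G _); split; lra.
Qed.

Lemma modified_cost_npos (s : R) :
  (forall x, x <= 0 -> c n x = 0) -> s <= 0 ->
  modified_cost delta alpha c n s = 0.
Proof.
rewrite /modified_cost => c0 s_le0; case: ifP => // s_ge0.
have -> : s = 0 by apply/eqP; rewrite eq_le s_le0.
by rewrite c0// set_itv1 Rintegral_set1 mul0r addr0 mulr0 addr0.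
Qed.

End ModifiedCost.

(** * Best responses *)

Section BestResponse.
Context {R : realFieldType} (delta K P b s w : R) (c d : R -> R).
Hypotheses (K_gt0 : 0 < K) (P_gt0 : 0 < P).
Hypotheses (b_ge0 : 0 <= b) (b_le : b <= P ^+ 2 * K).
Hypotheses (bE : b = P * (delta - s)) (wE : w = 2 * K * P - delta).
Hypothesis cd : slopes_within c d.
Local Notation W q := (w + K * (q - P)).

(* The other bids being fixed, total bids are [K q ^+ 2] at price [q], so a
   tenant can be seen as choosing the price [q], at which it bids
   [b + K (q ^+ 2 - P ^+ 2)]. *)
Definition best_price : Prop :=
  forall q : R, 0 < q -> 0 <= b + K * (q ^+ 2 - P ^+ 2) ->
    q * delta - (b + K * (q ^+ 2 - P ^+ 2))
      - c (delta - (b + K * (q ^+ 2 - P ^+ 2)) / q)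
    <= P * delta - b - c s.

(** Moving the price from [P] to [q] lowers supply by [(q - P) * (W q + s) / q] and revenue by
    [(q - P) * W q]. As [q] tends to [P], the revenue lost per unit of supply tends to
    [P * w / (w + s)]. *)
Let deviation (q : R) : 0 < q ->
  q * (s - (delta - (b + K * (q ^+ 2 - P ^+ 2)) / q)) = (q - P) * (W q + s).
Proof. by move=> q0; rewrite bE wE; field; rewrite gt_eqF. Qed.

(** The bid [b] is at most the total [P ^+ 2 * K], hence [W q + s >= K * q]. So a price above [P]
    lowers supply and a price below [P] raises it. *)
Let Ws_gt0 (q : R) : 0 < q -> 0 < W q + s.
Proof.
move=> q0; have -> : W q + s = K * q + (P ^+ 2 * K - b) / P.
  by rewrite bE wE; field; rewrite gt_eqF.
by rewrite ltr_wpDr ?mulr_gt0// divr_ge0 ?(ltW P_gt0)// subr_ge0.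
Qed.

Let best_price_gap (q : R) :
  best_price -> 0 < q -> 0 <= b + K * (q ^+ 2 - P ^+ 2) ->
  exists2 x, q * (s - x) = (q - P) * (W q + s) &
    c s - c x <= (q - P) * W q.
Proof.
move=> best q0 bq; exists (delta - (b + K * (q ^+ 2 - P ^+ 2)) / q).
  exact: deviation.
by have := best q q0 bq; rewrite wE; lra.
Qed.

(** A slightly higher price lowers supply to some [x] between [u] and [s]. The cost saved, at least
    [d u * (s - x)], cannot exceed the revenue lost. *)
Lemma best_price_slope_le : best_price -> 0 <= d 0 ->
  forall u : R, 0 <= u -> u < s -> d u * (w + s) <= P * w.
Proof.
move=> best d0 u u0 us.
have [K0 P0] := conj K_gt0 P_gt0.
have du : 0 <= d u.
  by apply: (le_trans d0); apply: (slopes_within_nondecreasing cd).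
have ws : 0 < w + s by have := Ws_gt0 P P_gt0; rewrite subrr mulr0 addr0.
have wsK : 0 < w + s + K by lra.
(* The bound 1 on [e] turns [K * e * e] into a linear error; the second bound keeps the new supply
   above [u]. *)
apply: (@le_of_linear_error _ _ _ (K * P + w + K)
  (Num.min 1 ((s - u) * P / (w + s + K)))).
  by rewrite lt_min ltr01 divr_gt0// mulr_gt0// subr_gt0.
move=> e e0; rewrite lt_min ltr_pdivlMr// => /andP[e1 eu].
pose q := P + e; have q0 : 0 < q by rewrite /q; lra.
have qP : q - P = e by rewrite /q; ring.
have Ke : K * e <= K by rewrite -[leRHS]mulr1 ler_pM2l// ltW.
have Ke0 : 0 < K * e by rewrite mulr_gt0.
have bq : 0 <= b + K * (q ^+ 2 - P ^+ 2).
  have -> : K * (q ^+ 2 - P ^+ 2) = K * e * (2 * P + e) by rewrite /q; ring.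
  by rewrite addr_ge0// mulr_ge0//; lra.
have Wqs := Ws_gt0 q q0.
have [x xE gap] := best_price_gap q best q0 bq.
rewrite qP in Wqs xE gap.
have xs : x < s.
  have : 0 < q * (s - x) by rewrite xE mulr_gt0.
  by rewrite pmulr_rgt0// subr_gt0.
have ux : u < x.
  have h1 : e * (w + K * e + s) <= e * (w + s + K) by rewrite ler_pM2l//; lra.
  have h2 : (s - u) * P < (s - u) * q by rewrite ltr_pM2l ?subr_gt0// /q; lra.
  have : q * (s - x) < q * (s - u) by lra.
  by rewrite ltr_pM2l//; lra.
have [h1 _] := cd x s ltac:(lra) xs.
have h2 := slopes_within_nondecreasing cd u x u0 (ltW ux).
have h3 : d u * (s - x) <= e * (w + K * e).
  apply: le_trans (le_trans h1 gap).
  by rewrite ler_wpM2r//; lra.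
have h4 : e * (d u * (w + K * e + s)) <= e * ((w + K * e) * q).
  have -> : e * (d u * (w + K * e + s)) = q * (d u * (s - x)).
    by rewrite mulrCA -xE; ring.
  have -> : e * ((w + K * e) * q) = q * (e * (w + K * e)) by ring.
  by rewrite ler_pM2l.
rewrite ler_pM2l// in h4.
have h5 : 0 <= d u * (K * e) by rewrite mulr_ge0// ltW.
have h6 : K * e * e <= K * e by rewrite -[leRHS]mulr1 ler_pM2l// ltW.
rewrite /q in h4.
lra.
Qed.

(** Lowering the price by [e] means lowering the bid, which [0 < b] permits. *)
Let lower_price (u : R) : best_price -> s < u -> 0 < b ->
  exists2 e0, 0 < e0 & forall e, 0 < e -> e < e0 ->
    e < P /\ exists x, [/\ s < x, x < u,
      (P - e) * (x - s) = e * (w - K * e + s) & e * (w - K * e) <= c x - c s].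
Proof.
move=> best su b0.
have [K0 P0] := conj K_gt0 P_gt0.
have ws : 0 < w + s by have := Ws_gt0 P P_gt0; rewrite subrr mulr0 addr0.
(* In order, the bounds keep the new price above [P / 2], the new supply below [u] and the new bid
   nonnegative. *)
exists (Num.min (P / 2) (Num.min ((u - s) * P / 2 / (w + s)) (b / (2 * P * K)))).
  by rewrite !lt_min !divr_gt0 ?mulr_gt0// subr_gt0.
move=> e e0; rewrite !lt_min => /and3P[eP].
rewrite !ltr_pdivlMr ?mulr_gt0// => eu eb.
pose q := P - e; have q0 : 0 < q by rewrite /q; lra.
have qP : q - P = - e by rewrite /q; ring.
have Ke0 : 0 < K * e by rewrite mulr_gt0.
have bq : 0 <= b + K * (q ^+ 2 - P ^+ 2).
  have -> : b + K * (q ^+ 2 - P ^+ 2) = b - e * (2 * P * K) + K * e * e.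
    by rewrite /q; ring.
  by rewrite addr_ge0 ?mulr_ge0 ?(ltW e0) ?(ltW Ke0)//; lra.
have Wqs := Ws_gt0 q q0.
have [x xE gap] := best_price_gap q best q0 bq.
rewrite qP mulrN in Wqs xE gap.
split; first lra.
exists x; rewrite -/q; split.
- have : 0 < q * (x - s).
    have -> : q * (x - s) = e * (w - K * e + s) by lra.
    by rewrite mulr_gt0.
  by rewrite pmulr_rgt0// subr_gt0.
- have h1 : e * (w - K * e + s) <= e * (w + s) by rewrite ler_pM2l//; lra.
  have h2 : (u - s) * (P / 2) < (u - s) * q.
    by rewrite ltr_pM2l ?subr_gt0// /q; lra.
  have : q * (x - s) < q * (u - s) by lra.
  by rewrite ltr_pM2l//; lra.
- by rewrite -/q; lra.
- lra.
Qed.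

Lemma best_price_slope_ge : best_price -> 0 <= d 0 -> 0 <= s -> 0 < b ->
  0 < w -> forall u : R, s < u -> P * w <= d u * (w + s).
Proof.
move=> best d0 s0 b0 w0 u su.
have [K0 P0] := conj K_gt0 P_gt0.
have [e0 e00 He] := lower_price u best su b0.
apply: (@le_of_linear_error _ _ _ (K * P + w) e0) => // e ep ee0.
have [eP [x [sx xu xE gap]]] := He e ep ee0.
have [_ h1] := cd s x s0 sx.
have h2 := slopes_within_nondecreasing cd x u ltac:(lra) (ltW xu).
have h3 : e * (w - K * e) <= d u * (x - s).
  by apply: (le_trans gap); apply: (le_trans h1); rewrite ler_wpM2r//; lra.
have h4 : e * ((w - K * e) * (P - e)) <= e * (d u * (w - K * e + s)).
  have -> : e * (d u * (w - K * e + s)) = (P - e) * (d u * (x - s)).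
    by rewrite mulrCA -xE; ring.
  have -> : e * ((w - K * e) * (P - e)) = (P - e) * (e * (w - K * e)) by ring.
  by rewrite ler_pM2l//; lra.
rewrite ler_pM2l// in h4.
have du : 0 <= d u.
  by apply: (le_trans d0); apply: (slopes_within_nondecreasing cd) => //; lra.
have h5 : 0 <= d u * (K * e) by rewrite !mulr_ge0// ltW.
have h6 : 0 <= K * e * e by rewrite !mulr_ge0// ltW.
lra.
Qed.

(** At a negative supply, a small price cut keeps supply negative, at zero cost, and raises revenue
    by [e * (w - K * e)]. *)
Lemma best_price_supply_ge0 : best_price -> (forall x : R, x <= 0 -> c x = 0) ->
  0 <= delta -> 0 < w -> 0 <= s.
Proof.
move=> best c0 delta0 w0; rewrite leNgt; apply/negP => s0.
have b0 : 0 < b by rewrite bE mulr_gt0//; lra.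
have [e0 e00 He] := lower_price 0 best s0 b0.
pose e := Num.min (e0 / 2) (w / K / 2).
have ep : 0 < e by rewrite lt_min !divr_gt0.
have ee0 : e < e0 by rewrite gt_min; apply/orP; left; lra.
have eK : e * K <= w / 2.
  by rewrite -ler_pdivlMr// mulrAC ge_min lexx orbT.
have [_ [x [_ x0 _ gap]]] := He e ep ee0.
rewrite !c0 ?(ltW x0) ?(ltW s0)// subrr pmulr_rle0// in gap.
lra.
Qed.

(** By the subgradient inequality it suffices that the revenue gained is at most [P * w / (w + s)]
    times the supply gained. *)
Lemma best_price_of_subgradient : 0 < w -> 0 <= s ->
  (forall t, P * w / (w + s) * (t - s) <= c t - c s) -> best_price.
Proof.
move=> w0 s0 sub q q0 bq.
have [K0 P0] := conj K_gt0 P_gt0.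
have := deviation q q0; have Wqs := Ws_gt0 q q0.
have := sub (delta - (b + K * (q ^+ 2 - P ^+ 2)) / q).
move: (delta - _ / q) => x {}sub xE.
set f := P * w / (w + s) in sub.
have ws : 0 < w + s by lra.
have fE : f * (w + s) = P * w by rewrite /f divfK ?gt_eqF.
have f0 : 0 <= f by rewrite divr_ge0 ?mulr_ge0// ltW.
clearbody f.
set y := q - P in Wqs xE *.
suff : - y * W q <= c x - c s by rewrite wE /y; lra.
apply: (le_trans _ sub).
rewrite -(ler_pM2l q0) -/y.
have -> : q * (f * (x - s)) = - (f * (q * (s - x))) by ring.
rewrite xE.
(* A price with [W q < 0] is below [P] and loses revenue while supply rises. Otherwise the gap,
   multiplied by [w + s], is [y ^+ 2] times a nonnegative factor. *)
have [W0|W0] := leP 0 (w + K * y); last first.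
  have y0 : y < 0.
    have : K * y < 0 by lra.
    by rewrite pmulr_rlt0.
  apply: (@le_trans _ _ 0).
    by rewrite pmulr_rle0// mulNr oppr_le0 mulr_le0// ltW.
  by rewrite oppr_ge0 mulr_ge0_le0// mulr_le0_ge0// ltW.
rewrite -subr_ge0 -(pmulr_lge0 _ ws).
have -> : (- (f * (y * (w + K * y + s))) - q * (- y * (w + K * y))) * (w + s) =
   y * (q * (w + K * y) * (w + s) - (f * (w + s)) * (w + K * y + s)) by ring.
rewrite fE.
have -> : q * (w + K * y) * (w + s) - P * w * (w + K * y + s) =
    y * (w * (w + K * y) + s * (w + K * q)) by rewrite /y; ring.
rewrite mulrA -expr2 mulr_ge0 ?sqr_ge0// addr_ge0 ?mulr_ge0//; try exact: ltW.
by rewrite addr_ge0 ?mulr_ge0//; exact: ltW.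
Qed.

End BestResponse.

(** * The market *)

Lemma sum_with (V : zmodType) (T : Type) (N : nat) (F : 'I_N -> T -> V)
    (s : 'I_N -> T) (n : 'I_N) (t : T) :
  \sum_i F i ([eta s with n |-> t] i) = \sum_i F i (s i) - F n (s n) + F n t.
Proof.
rewrite (bigD1 n)//= [in RHS](bigD1 n)//= eqxx.
rewrite (addrC (F n (s n))) addrK [RHS]addrC.
by congr (_ + _); apply: eq_bigr => i /negPf ->.
Qed.

Lemma continuous_bigsum (R : realType) (T : topologicalType) (I : Type)
    (r : seq I) (g : I -> T -> R) :
  (forall i, continuous (g i)) -> continuous (fun v => \sum_(i <- r) g i v).
Proof.
move=> cg; elim: r => [|i r IH] x.
  by under eq_fun do rewrite big_nil; exact: cvg_cst.
by under eq_fun do rewrite big_cons; apply: cvgD; [exact: cg|exact: IH].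
Qed.

(** * Feasible points and existence of minimizers *)

Section Feasible.
Context {R : realType} {N : nat} (delta : R).

Lemma feasible_with (s : 'I_N -> R) (y : R) (n : 'I_N) (t : R) :
  feasible delta (s, y) -> 0 <= t -> t <= s n + y ->
  feasible delta ([eta s with n |-> t] : 'I_N -> R, y + (s n - t)).
Proof.
move=> [/= sum_sy s0 y0] t0 ty; split => /=.
- by rewrite (sum_with _ _ _ (fun=> id)) -sum_sy; ring.
- by move=> i /=; case: ifP.
- lra.
Qed.

(** The balance constraint determines [y] from the supplies, and these range over a compact set of
    row vectors, where a continuous function attains its minimum. *)
Lemma continuous_argmin (F : 'I_N -> R -> R) (q : R -> R) : 0 <= delta ->
  (forall n, continuous (F n)) -> continuous q ->
  exists sy, argmin (feasible delta) (fun sy => \sum_i F i (sy.1 i) + q sy.2) sy.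
Proof.
move=> delta0 cF cq.
pose A := [set v : 'rV[R]_N | \sum_i v ord0 i <= delta] `&`
  [set v : 'rV[R]_N | forall i, v ord0 i \in `[0, delta]].
pose f (v : 'rV[R]_N) :=
  \sum_i F i (v ord0 i) + q (delta - \sum_i v ord0 i).
have csum : continuous (fun v : 'rV[R]_N => \sum_i v ord0 i).
  by apply: continuous_bigsum => i; exact: coord_continuous.
have cptA : compact A.
  have cptB : compact [set v : 'rV[R]_N | forall i, v ord0 i \in `[0, delta]].
    apply: (@rV_compact _ _ (fun=> `[0, delta]%classic)) => i.
    exact: segment_compact.
  apply: (subclosed_compact _ cptB); last by move=> v [].
  apply: closedI; last exact: compact_closed.
  apply: (@closed_comp _ _ (fun v : 'rV[R]_N => \sum_i v ord0 i)
    [set z | z <= delta]); first by move=> v _; exact: csum.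
  exact: closed_le.
have c1 : continuous (fun v : 'rV[R]_N => \sum_i F i (v ord0 i)).
  apply: continuous_bigsum => i v; apply: continuous_comp; last exact: cF.
  exact: coord_continuous.
have c2 : continuous (fun v : 'rV[R]_N => q (delta - \sum_i v ord0 i)).
  have c3 : continuous (fun v : 'rV[R]_N => delta - \sum_i v ord0 i).
    by move=> v; apply: cvgB (csum v); exact: cvg_cst.
  by move=> v; exact: continuous_comp (c3 v) (cq _).
have cf : continuous f by move=> v; exact: cvgD (c1 v) (c2 v).
have A0 : A !=set0.
  exists 0; split => /=.
    by rewrite big1// => i _; rewrite mxE.
  by move=> i; rewrite mxE in_itv/= lexx.
have [v vA fv] := EVT_min_rV A0 cptA (continuous_subspaceT cf).
move: vA; rewrite inE => -[/= sv v0].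
exists (fun i => v ord0 i, delta - \sum_i v ord0 i); split.
  split => /=; first by rewrite subrK.
    by move=> i; have := v0 i; rewrite in_itv/= => /andP[].
  by rewrite subr_ge0.
move=> [s y] [/= sum_sy s0 y0].
have sE : \sum_i s i = delta - y by rewrite -sum_sy; ring.
pose r : 'rV[R]_N := \row_i s i.
have rE i : r ord0 i = s i by rewrite mxE.
have rS : \sum_i r ord0 i = delta - y by rewrite -sE; exact: eq_bigr.
have rF : \sum_i F i (r ord0 i) = \sum_i F i (s i).
  by apply: eq_bigr => i _; rewrite rE.
have := fv r; rewrite /f rS rF opprB addrCA subrr addr0; apply.
rewrite inE; split => /=; first by rewrite rS; lra.
move=> i; rewrite in_itv/= rE s0/=.
apply: (@le_trans _ _ (\sum_i s i)); last by rewrite sE; lra.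
by rewrite (bigD1 i)//= lerDl sumr_ge0.
Qed.

End Feasible.

(** * Payoffs and the operator's choice in terms of the price *)

Section Payoff.
Context {R : realType} {N : nat} (delta alpha : R).
Hypotheses (N_gt0 : (0 < N)%N) (delta_gt0 : 0 < delta) (alpha_gt0 : 0 < alpha).
Local Notation K := (N%:R * delta / alpha).

Let N0 : 0 < N%:R :> R. Proof. by rewrite ltr0n. Qed.

Let K_gt0 : 0 < K.
Proof. by rewrite divr_gt0 ?mulr_gt0. Qed.

Lemma payoff_at_price (c : 'I_N -> R -> R) (n : 'I_N) (b : 'I_N -> R) (P : R) :
  0 < P -> \sum_i b i = P ^+ 2 * K ->
  payoff delta alpha c n b = P * delta - b n - c n (delta - b n / P).
Proof.
move=> P0 bP; have [N1 a1 d1] := And3 N0 alpha_gt0 delta_gt0.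
rewrite /payoff bP; congr (_ - _ - c n (_ - _)).
  have -> : P ^+ 2 * K * alpha * delta / N%:R = (P * delta) ^+ 2.
    by field; rewrite !gt_eqF.
  by rewrite sqrtr_sqr ger0_norm// mulr_ge0// ltW.
rewrite sqrtrM ?sqr_ge0// sqrtr_sqr ger0_norm ?(ltW P0)//.
have sK : 0 < Num.sqrt K by rewrite sqrtr_gt0.
by field; rewrite !gt_eqF.
Qed.

Section Operator.
Variables (b : 'I_N -> R) (P y : R).
Hypotheses (P_gt0 : 0 < P) (bP : \sum_i b i = P ^+ 2 * K).
Hypotheses (yP : (N%:R - 1) * delta + y = P * K).
Hypotheses (y_gt0 : 0 < y) (y_le : y <= delta).

Lemma clearing_price_at : clearing_price delta b y = P%:E.
Proof.
rewrite /clearing_price yP bP inver mulf_eq0 !gt_eqF//= -EFinM.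
by congr EFin; field; rewrite !gt_eqF.
Qed.

(* With [D] the total supply bid for, the operator's cost is
   [alpha (P ^+ 2 K ^+ 2 / D + D)] up to a constant, with minimum at [D = P K]. *)
Lemma operator_cost_min (x : R) : 0 <= x -> x != y ->
  (operator_cost delta alpha b y < operator_cost delta alpha b x)%E.
Proof.
move=> x0 xy; rewrite {1}/operator_cost clearing_price_at -EFinM -EFinD.
have [N1 a1 d1] := And3 N0 alpha_gt0 delta_gt0.
have [K1 P1 yP1] := And3 K_gt0 P_gt0 yP.
have NK : N%:R * delta = alpha * K by field; rewrite gt_eqF.
rewrite /operator_cost /clearing_price bP.
have D0 : 0 <= (N%:R - 1) * delta + x.
  by rewrite addr_ge0// mulr_ge0 ?(ltW d1)// subr_ge0 ler1n.
have xE : x = (N%:R - 1) * delta + x - P * K + y by rewrite -yP1; ring.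
set D := (N%:R - 1) * delta + x in D0 xE *.
(* [D = 0] means a single tenant and [x = 0]; the price and the cost are then [+oo]. *)
rewrite inver; case: ifPn => [/eqP D00|Dn0].
  rewrite gt0_muley; last by rewrite lte_fin mulr_gt0// exprn_gt0.
  have xd : 0 < delta - x.
    have : 0 < delta * N%:R by rewrite mulr_gt0.
    by move: D00; rewrite /D; lra.
  by rewrite gt0_muley ?lte_fin// ltry.
have Dp : 0 < D by rewrite lt_neqAle eq_sym Dn0.
rewrite -!EFinM -EFinD lte_fin -subr_gt0.
have -> : (delta - x) * (P ^+ 2 * K / D) + alpha * x -
    ((delta - y) * P + alpha * y) = alpha * (D - P * K) ^+ 2 / D.
  have dy : delta - y = N%:R * delta - P * K by rewrite -yP1; ring.
  have dx : delta - x = N%:R * delta - D by rewrite /D; ring.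
  rewrite dx dy NK.
  have -> : alpha * x = alpha * (D - P * K) + alpha * y by rewrite {1}xE; ring.
  move: (D) Dn0 => D1 D1n0; field; by rewrite D1n0 gt_eqF.
apply: divr_gt0 => //; apply: mulr_gt0 => //.
rewrite lt_neqAle sqr_ge0 andbT eq_sym sqrf_eq0.
apply: contraNneq xy => /eqP; rewrite subr_eq0 => /eqP DP.
by apply/eqP; rewrite xE DP; ring.
Qed.

Lemma operator_argminE (x : R) :
  argmin `[0, delta] (operator_cost delta alpha b) x <-> x = y.
Proof.
have yin : y \in `[0, delta] by rewrite in_itv/= ltW.
split=> [[/= + xmin]|->].
  rewrite in_itv/= => /andP[x0 _]; apply/eqP/negPn/negP => xy.
  by have := xmin y yin; rewrite leNgt operator_cost_min.
split => //= x'; rewrite in_itv/= => /andP[x'0 _].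
by have [->//|x'y] := eqVneq x' y; rewrite ltW ?operator_cost_min.
Qed.

End Operator.
End Payoff.

(** * Equilibria as critical points of the modified problem *)

Section Equilibrium.
Context {R : realType} {N : nat} {delta alpha a k K : R} {c : 'I_N -> R -> R}.
Local Notation d n := (right_derivative (c n)).
Hypotheses (N_gt0 : (0 < N)%N) (delta_gt0 : 0 < delta) (alpha_gt0 : 0 < alpha).
Hypotheses (aE : a = alpha / (2 * N%:R)) (kE : k = alpha / (N%:R * delta))
  (KE : K = N%:R * delta / alpha).
Hypothesis cd : forall n, slopes_within (c n) (d n).
Hypothesis c_npos : forall n (x : R), x <= 0 -> c n x = 0.
Hypothesis d_ge : forall n, a <= d n 0.
Hypothesis onsite : exists (s : 'I_N -> R) (y : R),
  argmin (feasible delta) (social_cost alpha c) (s, y) /\ 0 < y.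

Local Notation H n z := (modified_marginal a k (d n z) z).
Local Notation F := (modified_cost delta alpha c).
Local Notation P y := (k * ((N%:R - 1) * delta + y)).

Let constants : [/\ [/\ 0 < a, 0 < k, 0 < K & k * K = 1],
  delta = 2 * K * a, alpha = k * (N%:R * delta), 0 < delta & 1 <= N%:R :> R].
Proof.
have N0 : 0 < N%:R :> R by rewrite ltr0n.
rewrite aE kE KE; split => //; last by rewrite ler1n.
- by split; rewrite ?divr_gt0 ?mulr_gt0//; field; rewrite !gt_eqF.
- by field; rewrite !gt_eqF.
- by field; rewrite !gt_eqF.
Qed.

Let d_ge_reserve n (u : R) : 0 <= u -> a <= d n u.
Proof.
by move=> u0; apply: (le_trans (d_ge n)); apply: (slopes_within_nondecreasing (cd n)).
Qed.

Let Fd n : slopes_within (F n) (fun z => H n z).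
Proof.
by have := d_ge n; rewrite aE kE => dn; exact: modified_cost_slopes_within.
Qed.

(* Where on-site generation is used at the social optimum, supplying more than
   there has marginal cost at least [alpha]. *)
Lemma supply_lt_target (s : 'I_N -> R) :
  (forall n (u : R), 0 < u -> u < s n -> d n u < alpha) -> \sum_i s i < delta.
Proof.
move=> sd; have [r [y [[[/= sum_ry r0 y0] opt] y_gt0]]] := onsite.
have rd n (u : R) : r n < u -> alpha <= d n u.
  apply: (slopes_ge_of_subgradient (cd n) (r n) alpha 0 y) => // t rt ty.
  have fry : feasible delta (r, y) by split.
  have t0 : 0 <= t by have := r0 n; lra.
  have := opt _ (feasible_with _ _ _ _ _ fry t0 ty).
  have := sum_with _ _ _ c r n t; rewrite /social_cost /= => ->.
  lra.
have sr : \sum_i s i <= \sum_i r i.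
  apply: ler_sum => n _; rewrite leNgt; apply/negP => rs.
  have rn := r0 n.
  have := rd n ((r n + s n) / 2) ltac:(lra).
  have := sd n ((r n + s n) / 2) ltac:(lra) ltac:(lra).
  lra.
lra.
Qed.

(** [P] is increasing and takes the value [alpha] at [delta]. *)
Let price_lt_alpha (y : R) : y <= 0 -> P y < alpha.
Proof.
move=> y0; have [[a0 k0 K0 kK] _ -> dl N1] := constants.
by rewrite ltr_pM2l//; lra.
Qed.

(* First-order conditions of the modified problem; [P y] is the derivative of
   its quadratic term. *)
Definition critical (s : 'I_N -> R) (y : R) : Prop :=
  [/\ feasible delta (s, y), 0 < y, a < P y &
    forall n, (forall u : R, 0 <= u -> u < s n -> H n u <= P y) /\
              (forall u : R, s n < u -> P y <= H n u)].

Let quadratic_diff (y z : R) :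
  alpha / (2 * N%:R * delta) * (z + (N%:R - 1) * delta) ^+ 2
    - alpha / (2 * N%:R * delta) * (y + (N%:R - 1) * delta) ^+ 2
  = P y * (z - y) + k / 2 * (z - y) ^+ 2.
Proof.
have N0 : 0 < N%:R :> R by rewrite ltr0n.
by rewrite kE; field; rewrite !gt_eqF.
Qed.

Lemma critical_unique_argmin (s : 'I_N -> R) (y : R) : critical s y ->
  unique (argmin (feasible delta) (modified_social_cost delta alpha c)) (s, y).
Proof.
move=> [fsy y_gt0 aP Hs].
have [[a0 k0 K0 kK] _ _ dl N1] := constants.
have [/= sum_sy s0 y0] := fsy.
(* Both points are balanced, so [P y * (z - y)], the linear part of the quadratic term, is [- P y]
   times the change in total supply and can be spread over the tenants. Each summand is then a
   subgradient gap. *)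
have gap (r : 'I_N -> R) (z : R) : feasible delta (r, z) ->
    modified_social_cost delta alpha c (r, z) -
    modified_social_cost delta alpha c (s, y) =
    \sum_i (F i (r i) - F i (s i) - P y * (r i - s i)) + k / 2 * (z - y) ^+ 2.
  move=> [/= sum_rz _ _]; rewrite /modified_social_cost /=.
  have := quadratic_diff y z.
  rewrite !sumrB -mulr_sumr sumrB.
  have -> : \sum_i r i = delta - z by rewrite -sum_rz; ring.
  have -> : \sum_i s i = delta - y by rewrite -sum_sy; ring.
  lra.
have sub n (t : R) : 0 <= t -> 0 <= F n t - F n (s n) - P y * (t - s n).
  move=> t0; rewrite subr_ge0; have [h1 h2] := Hs n.
  exact: (subgradient_of_slopes (Fd n) (s n) _ (s0 n) h1 h2).
have H_lt n (x t : R) : 0 <= x -> x < t -> H n x < H n t.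
  move=> x0 xt; apply: modified_marginal_lt => //; first exact: d_ge_reserve.
  by apply: (slopes_within_nondecreasing (cd n)) => //; exact: ltW.
have strict n (t : R) : 0 <= t ->
    F n t - F n (s n) - P y * (t - s n) = 0 -> s n = t.
  move=> t0 eq0; apply/eqP/negPn/negP => st; have [h1 h2] := Hs n.
  rewrite eq_sym in st.
  have := strict_subgradient_of_slopes (Fd n) (s n) (P y) (H_lt n) (s0 n) h1 h2 t t0 st.
  lra.
have min r z : feasible delta (r, z) ->
    modified_social_cost delta alpha c (s, y) <=
    modified_social_cost delta alpha c (r, z).
  move=> frz; rewrite -subr_ge0 gap// addr_ge0//.
    by apply: sumr_ge0 => i _; apply: sub; case: frz.
  by rewrite mulr_ge0 ?sqr_ge0// divr_ge0 ?(ltW k0).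
split; first by split => // -[r z]; exact: min.
move=> [r z] [frz rmin].
have [/= sum_rz r0 z0] := frz.
have T0 : 0 <= \sum_i (F i (r i) - F i (s i) - P y * (r i - s i)).
  by apply: sumr_ge0 => i _; exact: sub.
have T : \sum_i (F i (r i) - F i (s i) - P y * (r i - s i)) = 0.
  apply/eqP; rewrite eq_le T0 andbT.
  have := gap r z frz; have := rmin _ fsy.
  have : 0 <= k / 2 * (z - y) ^+ 2.
    by rewrite mulr_ge0 ?sqr_ge0// divr_ge0 ?(ltW k0).
  lra.
have rs : s = r.
  apply/funext => n; apply: strict => //.
  by apply: (psumr_eq0P _ T) => // i _; exact: sub.
by congr (_, _) => //; move: sum_sy sum_rz; rewrite rs; lra.
Qed.

Lemma argmin_critical (s : 'I_N -> R) (y : R) :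
  argmin (feasible delta) (modified_social_cost delta alpha c) (s, y) ->
  critical s y.
Proof.
move=> [fsy opt]; have [/= sum_sy s0 y0] := fsy.
have [[a0 k0 K0 kK] da ak dl N1] := constants.
have opt1 n (t : R) : 0 <= t -> t <= s n + y ->
    P y * (t - s n) <= F n t - F n (s n) + k / 2 * (t - s n) ^+ 2.
  move=> t0 ty; have := opt _ (feasible_with _ _ _ _ _ fsy t0 ty).
  have := sum_with _ _ _ F s n t; rewrite /modified_social_cost /= => ->.
  have := quadratic_diff y (y + (s n - t)); lra.
have low n (u : R) : 0 <= u -> u < s n -> H n u <= P y.
  apply: (slopes_le_of_subgradient (Fd n) (s n) (P y) (k / 2)) => t t0 ts.
  by have := opt1 n t t0 ltac:(lra); lra.
have Hgt n (u : R) : 0 < u -> a < H n u /\ d n u < H n u.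
  move=> u0; have := modified_marginal_gt a k a0 k0 (d n u) u.
  by move=> /(_ (d_ge_reserve n u (ltW u0)) u0); rewrite gt_max => /andP[].
(* If [P y <= a], a positive supply would have marginals above [P y]; so all supplies vanish and
   [y >= delta], which gives [P y >= k * delta = 2 * a]. *)
have aP : a < P y.
  rewrite ltNge; apply/negP => Pa.
  have sz n : s n <= 0.
    rewrite leNgt; apply/negP => sn.
    have := low n (s n / 2) ltac:(lra) ltac:(lra).
    have [] := Hgt n (s n / 2) ltac:(lra).
    lra.
  have sz0 : \sum_i s i <= 0 by apply: sumr_le0 => i _; exact: sz.
  have yd : delta <= y by lra.
  have : k * (N%:R * delta) <= P y by rewrite ler_pM2l//; lra.
  have h1 : k * delta <= k * (N%:R * delta).
    by rewrite ler_pM2l// ler_peMl// ltW.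
  have h2 : k * delta = 2 * a by rewrite da -[RHS]mul1r -kK; ring.
  lra.
have y_gt0 : 0 < y.
  rewrite ltNge; apply/negP => y_le0.
  have := price_lt_alpha y y_le0 => Pal.
  have : \sum_i s i < delta.
    apply: supply_lt_target => n u u0 us.
    have := low n u (ltW u0) us; have [_] := Hgt n u u0; lra.
  lra.
split=> // n; split; first exact: low.
apply: (slopes_ge_of_subgradient (Fd n) (s n) (P y) (k / 2) y) => // t st ty.
by apply: opt1 => //; have := s0 n; lra.
Qed.

Lemma modified_argmin_exists : exists sy,
  argmin (feasible delta) (modified_social_cost delta alpha c) sy.
Proof.
apply: (@continuous_argmin _ _ delta F (fun y =>
  alpha / (2 * N%:R * delta) * (y + (N%:R - 1) * delta) ^+ 2)).
  exact: ltW.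
  move=> n; apply: (slopes_within_continuous _ _ _ (Fd n)) => x x0.
  by apply: modified_cost_npos => // z; exact: c_npos.
move=> y; apply: cvgM; first exact: cvg_cst.
by apply: cvgM; apply: cvgD; [exact: cvg_id|exact: cvg_cst|exact: cvg_id|exact: cvg_cst].
Qed.

Lemma best_responseP (b : 'I_N -> R) (p : R) (n : 'I_N) :
  0 < p -> \sum_i b i = p ^+ 2 * K -> (forall i, 0 <= b i) ->
  (forall x : R, valid_bids [eta b with n |-> x] ->
     payoff delta alpha c n [eta b with n |-> x] <= payoff delta alpha c n b)
  <-> best_price delta K p (b n) (delta - b n / p) (c n).
Proof.
move=> p0 bp b0; have [[a0 k0 K0 kK] _ _ dl N1] := constants.
have payE q (b' : 'I_N -> R) : 0 < q -> \sum_i b' i = q ^+ 2 * K ->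
    payoff delta alpha c n b' = q * delta - b' n - c n (delta - b' n / q).
  by move=> q0; rewrite KE => bq; exact: payoff_at_price.
have sumE x : \sum_i [eta b with n |-> x] i = p ^+ 2 * K - b n + x.
  by rewrite (sum_with _ _ _ (fun=> id)) bp.
have withE x : [eta b with n |-> x] n = x by rewrite /= eqxx.
split=> [best q q0 xq|best x [x0 xS]].
  set x := b n + K * (q ^+ 2 - p ^+ 2) in xq *.
  have xS : \sum_i [eta b with n |-> x] i = q ^+ 2 * K.
    by rewrite sumE /x; ring.
  rewrite -(payE _ _ p0 bp) -{1 2}(withE x) -(payE _ _ q0 xS); apply: best.
  split; last by rewrite xS mulr_gt0// exprn_gt0.
  by move=> i /=; case: ifP.
(* [q] is the price at which the bids total [q ^+ 2 * K], so bidding [x] amounts to choosing the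
   price [q]. *)
pose q := Num.sqrt (k * (p ^+ 2 * K - b n + x)).
have q0 : 0 < q by rewrite sqrtr_gt0 mulr_gt0// -sumE.
have qE : q ^+ 2 * K = p ^+ 2 * K - b n + x.
  rewrite sqr_sqrtr; last by rewrite mulr_ge0 ?(ltW k0)// -sumE ltW.
  by rewrite mulrAC kK mul1r.
have xE : x = b n + K * (q ^+ 2 - p ^+ 2) by rewrite mulrBr !(mulrC K) qE; ring.
rewrite (payE _ _ p0 bp) (payE q) ?sumE ?qE// withE [in leLHS]xE.
by apply: best => //; rewrite -xE -(withE x).
Qed.

Lemma critical_equilibrium (s : 'I_N -> R) (y : R) : critical s y ->
  market_equilibrium delta alpha c (fun n => P y * (delta - s n)) (P y)%:E y.
Proof.
move=> [[/= sum_sy s0 y0] y_gt0 aP Hs].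
have [[a0 k0 K0 kK] da _ dl N1] := constants.
set p := P y in aP Hs *; have p0 : 0 < p by lra.
have pK : p * K = (N%:R - 1) * delta + y by rewrite /p mulrAC kK mul1r.
have s_lt n : s n < delta.
  have : s n <= \sum_i s i by rewrite (bigD1 n)//= lerDl sumr_ge0.
  lra.
set b := fun n => p * (delta - s n).
have b_gt0 n : 0 < b n by rewrite /b mulr_gt0// subr_gt0.
have bS : \sum_i b i = p ^+ 2 * K.
  rewrite -mulr_sumr sumrB sumr_const card_ord.
  have -> : p ^+ 2 * K = p * (p * K) by ring.
  by rewrite pK -[_ *+ N]mulr_natl -sum_sy; ring.
have y_le : y <= delta by rewrite -sum_sy lerDl sumr_ge0.
have pK' : (N%:R - 1) * delta + y = p * (N%:R * delta / alpha) by rewrite -KE.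
have bS' : \sum_i b i = p ^+ 2 * (N%:R * delta / alpha) by rewrite -KE.
split.
- split; first by move=> n; exact: ltW.
  by rewrite bS mulr_gt0// exprn_gt0.
- move=> n; apply/(best_responseP b p n p0 bS (fun i => ltW (b_gt0 i))).
  have -> : delta - b n / p = s n by rewrite /b; field; rewrite gt_eqF.
  pose w := 2 * K * p - delta.
  have wa : w = 2 * K * (p - a) by rewrite /w {1}da; ring.
  have w0 : 0 < w by rewrite wa !mulr_gt0// subr_gt0.
  have [Hlt Hgt] := Hs n.
  have sn0 := s0 n.
  have ws : 0 < w + s n by lra.
  (* Since [k * K = 1] and [w = 2 * K * (p - a)], the quadratic inequality that characterizes the
     modified marginal becomes a comparison of [x] with [p * w / (w + u)]. *)
  have HK (u x : R) : k * x * u <= 2 * (p - x) * (p - a) <-> x * (w + u) <= p * w.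
    rewrite -(ler_pM2l K0).
    have -> : K * (k * x * u) = (k * K) * (x * u) by ring.
    have -> : K * (2 * (p - x) * (p - a)) = (p - x) * w by rewrite wa; ring.
    by rewrite kK; split; lra.
  have HK' (u x : R) : 2 * (p - x) * (p - a) <= k * x * u <-> p * w <= x * (w + u).
    rewrite -(ler_pM2l K0).
    have -> : K * (k * x * u) = (k * K) * (x * u) by ring.
    have -> : K * (2 * (p - x) * (p - a)) = (p - x) * w by rewrite wa; ring.
    by rewrite kK; split; lra.
  have d_gt0 (u : R) : 0 <= u -> 0 < d n u.
    by move=> u0; apply: (lt_le_trans a0); exact: d_ge_reserve.
  have dlt (u : R) : 0 <= u -> u < s n -> d n u <= p * w / (w + s n).
    move=> u0 us; rewrite ler_pdivlMr//.
    (* The bound at [s n - e] involves [w + (s n - e)] instead of [w + s n], hence the error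
       [d n u * e]. *)
    apply: (@le_of_linear_error _ _ _ (d n u) (s n - u)); first lra.
    move=> e e0 es.
    have v0 : 0 <= s n - e by lra.
    have := Hlt (s n - e) v0 ltac:(lra).
    rewrite modified_marginal_le ?(ltW (d_gt0 _ v0))// => /HK.
    have := slopes_within_nondecreasing (cd n) u (s n - e) u0 ltac:(lra) => h1 h2.
    have : d n u * (w + (s n - e)) <= d n (s n - e) * (w + (s n - e)).
      by rewrite ler_pM2r//; lra.
    lra.
  have dgt (u : R) : s n < u -> p * w / (w + s n) <= d n u.
    move=> us; rewrite ler_pdivrMr//.
    apply: (@le_of_linear_error _ _ _ (d n u) (u - s n)); first lra.
    move=> e e0 es.
    have v0 : 0 <= s n + e by lra.
    have := Hgt (s n + e) ltac:(lra).
    rewrite modified_marginal_ge ?(ltW (d_gt0 _ v0))// => /HK'.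
    have := slopes_within_nondecreasing (cd n) (s n + e) u v0 ltac:(lra) => h1 h2.
    have : d n (s n + e) * (w + (s n + e)) <= d n u * (w + (s n + e)).
      by rewrite ler_pM2r//; lra.
    lra.
  have sub := subgradient_of_slopes (cd n) (s n) _ sn0 dlt dgt.
  apply: (@best_price_of_subgradient _ delta K p (b n) (s n) w) => //.
  + rewrite -bS (bigD1 n)//= lerDl sumr_ge0// => i _; exact: ltW.
  + move=> t; have [t0|t0] := leP 0 t; first exact: sub.
    have := sub 0 (lexx 0); rewrite (c_npos n 0)// (c_npos n t) ?(ltW t0)//.
    apply: le_trans; rewrite ler_wpM2l//; last lra.
    by apply: divr_ge0; [apply: mulr_ge0|]; exact: ltW.
- by rewrite (clearing_price_at delta alpha _ _ _ b p y).
- by apply/(operator_argminE delta alpha _ _ _ b p y).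
Qed.

Lemma equilibrium_critical (b : 'I_N -> R) (p : \bar R) (y : R) :
  market_equilibrium delta alpha c b p y -> exists s : 'I_N -> R,
  [/\ critical s y, 0 < P y, p = (P y)%:E & b = fun n => P y * (delta - s n)].
Proof.
move=> [[b0 bS0] best pE ymin].
have [[a0 k0 K0 kK] da ak dl N1] := constants.
pose q := Num.sqrt (k * \sum_i b i).
have q0 : 0 < q by rewrite sqrtr_gt0 mulr_gt0.
have bS : \sum_i b i = q ^+ 2 * K.
  rewrite sqr_sqrtr; last by rewrite mulr_ge0 ?ltW.
  by rewrite mulrAC kK mul1r.
pose s n := delta - b n / q.
have bE n : b n = q * (delta - s n) by rewrite /s; field; rewrite gt_eqF.
have b_le n : b n <= q ^+ 2 * K.
  by rewrite -bS (bigD1 n)//= lerDl sumr_ge0.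
have bestp n : best_price delta K q (b n) (s n) (c n).
  by apply/best_responseP => //; exact: best.
pose w := 2 * K * q - delta.
have wa : w = 2 * K * (q - a) by rewrite /w {1}da; ring.
have ws n : 0 < w + s n.
  rewrite -(pmulr_rgt0 _ q0).
  have -> : q * (w + s n) = q ^+ 2 * K + (q ^+ 2 * K - b n).
    by rewrite bE /w; ring.
  by rewrite ltr_wpDr ?subr_ge0// mulr_gt0// exprn_gt0.
have sS : \sum_i s i = N%:R * delta - q * K.
  rewrite sumrB sumr_const card_ord -mulr_suml bS -[_ *+ N]mulr_natl.
  by field; rewrite gt_eqF.
have d_gt0 n (u : R) : 0 <= u -> 0 < d n u.
  by move=> u0; apply: (lt_le_trans a0); exact: d_ge_reserve.
have dlt n := best_price_slope_le delta K q (b n) (s n) w (c n) (d n) K0 q0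
  (b0 n) (b_le n) (bE n) erefl (cd n) (bestp n) (ltW (d_gt0 n 0 (lexx 0))).
(* If [w <= 0], the bound [dlt] at 0 excludes positive supplies, while [2 * K * q <= delta] makes
   their sum [N%:R * delta - q * K] positive. *)
have w0 : 0 < w.
  rewrite ltNge; apply/negP => w_le0.
  have s_le0 n : s n <= 0.
    rewrite leNgt; apply/negP => sn.
    have := dlt n 0 (lexx 0) sn.
    have : 0 < d n 0 * (w + s n) by rewrite mulr_gt0// d_gt0.
    have : q * w <= 0 by rewrite pmulr_rle0.
    lra.
  have : \sum_i s i <= 0 by apply: sumr_le0 => i _; exact: s_le0.
  have : delta <= N%:R * delta by rewrite ler_peMl// ltW.
  by rewrite sS; move: w_le0; rewrite /w; lra.
have s0 n : 0 <= s n.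
  apply: (@best_price_supply_ge0 _ delta K q (b n) (s n) w (c n)) => //.
  - exact: c_npos.
  - exact: ltW.
have aq : a < q.
  by move: w0; rewrite wa pmulr_rgt0 ?mulr_gt0// subr_gt0.
(* [z] is the on-site generation for which the bids clear at price [q]. The operator's choice [y] is
   identified with it once [0 < z] and [z <= delta] are known. *)
pose z := q * K - (N%:R - 1) * delta.
have zK : (N%:R - 1) * delta + z = q * K by rewrite /z; ring.
have Pz : P z = q by rewrite zK mulrCA kK mulr1.
have sum_sz : z + \sum_i s i = delta by rewrite sS /z; ring.
have z0 : 0 < z.
  rewrite ltNge; apply/negP => z_le0.
  have := price_lt_alpha z z_le0; rewrite Pz => qal.
  have : \sum_i s i < delta.
    apply: supply_lt_target => n u u0 us.
    have h1 := dlt n u (ltW u0) us.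
    have dn := d_gt0 n u (ltW u0).
    have h2 : 0 <= d n u * s n by rewrite mulr_ge0// ltW.
    have : d n u * w <= q * w by lra.
    rewrite ler_pM2r//; lra.
  lra.
have z_le : z <= delta by rewrite -sum_sz lerDl sumr_ge0.
have s_lt n : s n < delta.
  have : s n <= \sum_i s i by rewrite (bigD1 n)//= lerDl sumr_ge0.
  lra.
have b_gt0 n : 0 < b n by rewrite bE mulr_gt0// subr_gt0.
have dgt n := best_price_slope_ge delta K q (b n) (s n) w (c n) (d n) K0 q0
  (b_le n) (bE n) erefl (cd n) (bestp n) (ltW (d_gt0 n 0 (lexx 0)))
  (s0 n) (b_gt0 n) w0.
have zK' : (N%:R - 1) * delta + z = q * (N%:R * delta / alpha) by rewrite -KE.
have bS' : \sum_i b i = q ^+ 2 * (N%:R * delta / alpha) by rewrite -KE.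
have yz : y = z.
  by move: ymin => /(operator_argminE delta alpha N_gt0 delta_gt0 alpha_gt0
    b q z q0 bS' zK' z0 z_le).
exists s; rewrite yz Pz; split => //.
- split; rewrite ?Pz//; first by split => //=; exact: ltW.
  have KH (u x : R) : K * (k * x * u) = x * u.
    by rewrite -[RHS]mul1r -kK; ring.
  have KH' (x : R) : K * (2 * (q - x) * (q - a)) = (q - x) * w.
    by rewrite wa; ring.
  (* As slopes are positive, for [u < s n] the bound with [w + s n] implies the one with [w + u],
     and symmetrically beyond [s n]. *)
  move=> n; split => u.
    move=> u0 us; rewrite modified_marginal_le ?(ltW (d_gt0 _ _ u0))//.
    rewrite -(ler_pM2l K0) KH KH'.
    have := dlt n u u0 us; have dn := d_gt0 n u u0.
    have : d n u * u <= d n u * s n by rewrite ler_pM2l// ltW.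
    lra.
  move=> us; have u0 : 0 <= u by rewrite (le_trans (s0 n))// ltW.
  rewrite modified_marginal_ge ?(ltW (d_gt0 _ _ u0))//.
  rewrite -(ler_pM2l K0) KH KH'.
  have := dgt n u us; have dn := d_gt0 n u u0.
  have : d n u * s n <= d n u * u by rewrite ler_pM2l// ltW.
  lra.
- by rewrite pE yz (clearing_price_at delta alpha _ _ _ b q z).
- exact/funext.
Qed.

End Equilibrium.

Theorem theorem7 (R : realType) (N : nat) (delta alpha : R)
    (c : 'I_N -> R -> R)
    (hN : (1 <= N)%N) (hdelta : 0 < delta) (halpha : 0 < alpha)
    (c_cont : forall n, continuous (c n))
    (c_npos : forall n s, s <= 0 -> c n s = 0)
    (c_convex : forall n,
       convex_function (`[0, +oo[%classic : set R^o) (c n : R^o -> R^o))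
    (c_incr : forall n (s t : R), 0 <= s -> s < t -> c n s < c n t)
    (c_deriv0 : forall n, alpha / (2 * N%:R) <= right_derivative (c n) 0)
    (h_onsite : exists (s : 'I_N -> R) (y : R),
       argmin (feasible delta) (social_cost alpha c) (s, y) /\ 0 < y) :
  (exists! e : ('I_N -> R) * \bar R * R,
     market_equilibrium delta alpha c e.1.1 e.1.2 e.2) /\
  (forall (b : 'I_N -> R) (p : \bar R) (y : R),
     market_equilibrium delta alpha c b p y ->
     exists s : 'I_N -> R,
       (forall n, supply delta (b n) p = (s n)%:E) /\
       unique (argmin (feasible delta) (modified_social_cost delta alpha c))
         (s, y)).
Proof.
have nd n (x t : R) : 0 <= x -> x < t -> c n x <= c n t.
  by move=> x0 xt; exact/ltW/c_incr.
have cd n := convex_slopes_within (c n) (c_convex n) (nd n).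
have critE := equilibrium_critical hN hdelta halpha erefl erefl erefl cd
  c_npos c_deriv0 h_onsite.
have critU := critical_unique_argmin hN hdelta halpha erefl erefl erefl cd
  c_deriv0.
split; last first.
  move=> b p y /critE[s [crit P0 -> ->]]; exists s; split; last exact: critU.
  move=> n; move: (alpha / _ * _) P0 => P P0.
  rewrite /supply inver gt_eqF// -EFinM -EFinB.
  by congr EFin; field; rewrite gt_eqF.
have [[s y] opt] := modified_argmin_exists hdelta halpha erefl erefl
  cd c_npos c_deriv0.
have crit := argmin_critical hN hdelta halpha erefl erefl erefl cd c_deriv0
  h_onsite s y opt.
eexists (_, _, _); split.
  exact: (critical_equilibrium hN hdelta halpha erefl erefl erefl cd c_npos
    c_deriv0 s y crit).
(* Any equilibrium comes from a critical point, which must be the unique optimum [(s, y)] and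
   determines both bids and price. *)
move=> [[b p] z] /= /critE[r [crit' _ -> ->]].
have [_ uniq] := critU _ _ crit.
by have [-> ->] := uniq (r, z) (critU _ _ crit').1.
Qed.
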